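(* Suppose there exists a constant $p_0>0$ such that for all $j\in\mathcal{J}$, $p_j(\xi)\le p_0$ almost surely. Fix $\epsilon>0$. Let $x^\epsilon$ be the $x$-component of the unique solution of the regularized two-stage problem $$0\le x\ \perp\ Cx-\mathbb{E}[\lambda(\xi)]+a\ge 0,$$ $$0\le\begin{pmatrix}y(\xi)\\ \lambda(\xi)\end{pmatrix}\ \perp\ \begin{pmatrix}\Pi(\xi)& I\\ -I&\epsilon I\end{pmatrix}\begin{pmatrix}y(\xi)\\ \lambda(\xi)\end{pmatrix}+\begin{pmatrix}-p(\xi)\\ x\end{pmatrix}\ge 0\quad\text{for a.e. }\xi\in\Xi.$$ Let $\xi_1,\xi_2,\dots$ be independent identically distributed samples of $\xi$, and for each positive integer $\nu$ let $x^\epsilon_\nu$ be the $x$-component of the unique solution $\big(x,(y(\xi_\ell),\lambda(\xi_\ell))_{\ell=1}^\nu\big)$ of the sample average approximation $$0\le x\ \perp\ Cx-\frac1\nu\sum_{\ell=1}^\nu\lambda(\xi_\ell)+a\ge 0,$$ $$0\le\begin{pmatrix}y(\xi_\ell)\\ \lambda(\xi_\ell)\end{pmatrix}\ \perp\ \begin{pmatrix}\Pi(\xi_\ell)& I\\ -I&\epsilon I\end{pmatrix}\begin{pmatrix}y(\xi_\ell)\\ \lambda(\xi_\ell)\end{pmatrix}+\begin{pmatrix}-p(\xi_\ell)\\ x\end{pmatrix}\ge 0,\quad \ell=1,\dots,\nu .$$ Then $x^\epsilon_\nu\to x^\epsilon$ with probability $1$ as $\nu\to\infty$.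
   Context: $J\ge 1$ is an integer and $\mathcal{J}=\{1,\dots,J\}$. $\xi$ is a random vector with support $\Xi\subseteq\mathbb{R}^d$ and induced probability space $(\Xi,\mathcal{F},P)$; ''a.e.'' and ''almost surely'' refer to $P$. $C=\mathrm{diag}(c_1,\dots,c_J)$ with all $c_j>0$; $a=(a_1,\dots,a_J)^T$ with all $a_j>0$. $p(\xi)=(p_1(\xi),\dots,p_J(\xi))^T$ with each $p_j:\Xi\to\mathbb{R}$ measurable. $\gamma:\Xi\to\mathbb{R}_+$ is measurable and there is a constant $\gamma_0>0$ with $\gamma(\xi)\ge\gamma_0$ for a.e. $\xi\in\Xi$. $\Pi(\xi)=\gamma(\xi)(ee^T+I)$, where $e=(1,\dots,1)^T\in\mathbb{R}^J$ and $I$ is the $J\times J$ identity. The notation $0\le u\perp v\ge0$ means $u\ge 0$, $v\ge 0$ componentwise and $u^Tv=0$. The unknowns of the regularized problem are $x\in\mathbb{R}^J$ and measurable $y,\lambda:\Xi\to\mathbb{R}^J$ (with $\lambda$ integrable so that $\mathbb{E}[\lambda(\xi)]$ makes sense); functions are identified when equal a.e. In the sample average problem the unknowns are $x\in\mathbb{R}^J$ and vectors $y(\xi_\ell),\lambda(\xi_\ell)\in\mathbb{R}^J$, $\ell=1,\dots,\nu$. Both problems have a unique solution for each $\epsilon>0$ (and each $\nu$; almost surely with respect to the samples). *)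

(* Defs.v *)
From HB Require Import structures.
From mathcomp Require Import all_boot all_order all_algebra.
From mathcomp Require Import all_classical all_reals all_analysis.
Set Implicit Arguments.
Unset Strict Implicit.
Unset Printing Implicit Defensive.
Import Order.TTheory GRing.Theory Num.Theory.
Import numFieldNormedType.Exports.
Local Open Scope classical_set_scope.
Local Open Scope ring_scope.

Notation borel_rV R d := (g_sigma_algebraType (@open 'rV[R]_d)).

Definition is_support (R : realType) (d : nat)
    (mu : probability (borel_rV R d) R) (Xi : set 'rV[R]_d) : Prop :=
  [/\ closed Xi, mu Xi = 1%E &
      forall F : set 'rV[R]_d, closed F -> mu F = 1%E -> Xi `<=` F].

Definition mutually_independent (R : realType) (dO dT : measure_display)
    (Omega : measurableType dO) (T : measurableType dT)
    (Pr : probability Omega R) (X : nat -> {RV Pr >-> T}) : Prop :=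
  forall (s : seq nat) (A : nat -> set T),
    uniq s -> (forall k, measurable (A k)) ->
    Pr (\bigcap_(k in [set` s]) (X k @^-1` A k)) =
    (\prod_(k <- s) Pr (X k @^-1` A k))%E.

Definition iid_samples (R : realType) (d0 dO dT : measure_display)
    (Omega0 : measurableType d0) (Omega : measurableType dO)
    (T : measurableType dT) (P0 : probability Omega0 R)
    (xi : {RV P0 >-> T}) (Pr : probability Omega R)
    (X : nat -> {RV Pr >-> T}) : Prop :=
  mutually_independent X /\
  forall (k : nat) (A : set T), measurable A ->
    distribution Pr (X k) A = distribution P0 xi A.

(* 0 <= u _|_ v >= 0 *)
Definition complementary (R : realType) (n : nat) (u v : 'cV[R]_n) : Prop :=
  [/\ forall i, 0 <= u i 0, forall i, 0 <= v i 0 & u^T *m v = 0].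

Definition Pi_mx (R : realType) (J : nat) (g : R) : 'M[R]_J :=
  let e : 'cV[R]_J := const_mx 1 in g *: (e *m e^T + 1%:M).

(* The second-stage problem at one scenario, where gamma and p take the values
   g and q. *)
Definition second_stage (R : realType) (J : nat) (eps g : R)
    (q x y lam : 'cV[R]_J) : Prop :=
  complementary (col_mx y lam)
    (block_mx (Pi_mx J g) 1%:M (- 1%:M) eps%:M *m col_mx y lam
     + col_mx (- q) x).

Definition regularized_solution (R : realType) (d J : nat)
    (mu : probability (borel_rV R d) R) (Xi : set 'rV[R]_d)
    (c : 'rV[R]_J) (a : 'cV[R]_J) (gamma : 'rV[R]_d -> R)
    (p : 'rV[R]_d -> 'cV[R]_J) (eps : R)
    (x : 'cV[R]_J) (y lam : 'rV[R]_d -> 'cV[R]_J) : Prop :=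
  [/\ forall j, measurable_fun (Xi : set (borel_rV R d)) (fun z => y z j 0),
      forall j, mu.-integrable Xi (fun z => (lam z j 0)%:E),
      complementary x
        (diag_mx c *m x - \col_j (\int[mu]_(z in Xi) lam z j 0) + a) &
      {ae mu, forall z, Xi z ->
        second_stage eps (gamma z) (p z) x (y z) (lam z)}].

Definition saa_solution (R : realType) (d J : nat)
    (c : 'rV[R]_J) (a : 'cV[R]_J) (gamma : 'rV[R]_d -> R)
    (p : 'rV[R]_d -> 'cV[R]_J) (eps : R)
    (nu : nat) (z : 'I_nu -> 'rV[R]_d)
    (x : 'cV[R]_J) (y lam : 'I_nu -> 'cV[R]_J) : Prop :=
  complementary x
    (diag_mx c *m x - nu%:R^-1 *: (\sum_(l < nu) lam l) + a) /\
  forall l, second_stage eps (gamma (z l)) (p (z l)) x (y l) (lam l).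

(* Main.v *)
Require Import Defs.
From HB Require Import structures.
From mathcomp Require Import all_boot all_order all_algebra.
From mathcomp Require Import all_classical all_reals all_analysis.
From mathcomp Require Import measurable_realfun ring lra zify.
Set Implicit Arguments.
Unset Strict Implicit.
Unset Printing Implicit Defensive.
Import Order.TTheory GRing.Theory Num.Theory.
Import numFieldNormedType.Exports.
Local Open Scope classical_set_scope.
Local Open Scope ring_scope.

(** The convergence is driven by one fixed bounded function of the scenario:
    the multiplier [lame] of the true solution [xe].

    For a given scenario the second stage makes the multiplier a decreasing
    function of [x]: if [lam] and [lam'] solve it for [x] and [x'], then
    [(x - x') . (lam - lam') <= 0], because [Pi] and [eps I] are positive
    semidefinite and the two off-diagonal blocks cancel
    ([second_stage_antitone]).  Compare now the sample average solution [x]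
    with [xe], using at the sampled scenarios the multipliers [lame] as
    competitors.  The first-stage complementarity conditions give
      [(x - xe) . C (x - xe) <= (x - xe) . (mean of lam - E lame)],
    and replacing [lam] by [lame] on the right only increases it, by
    monotonicity.  As [C] is positive definite, [x - xe] is controlled by
    [mean of lame - E lame], the error of an ordinary Monte Carlo mean
    ([saa_solution_error]).

    Where a multiplier is positive the corresponding [y] is positive too, so
    that its complementarity condition is an equation which bounds the
    multiplier by [p <= p0] ([second_stage_multiplier_bounds]).  Hence [lame]
    is bounded and the strong law of large numbers for bounded variables is
    enough ([bounded_iid_strong_law]).  That law follows from a second moment
    estimate: the squared means along the perfect squares have summable
    expectations, hence tend to [0] almost surely, and bounded increments
    carry the convergence over the gaps between consecutive squares. *)

(** * Complementarity and monotonicity of the second stage *)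

Lemma complementary_entry (R : realType) (n : nat) (u v : 'cV[R]_n) i :
  complementary u v -> u i 0 * v i 0 = 0.
Proof.
move=> [u0 v0 /matrixP/(_ 0 0)]; rewrite !mxE => uv0.
have /eqP : \sum_k u k 0 * v k 0 = 0.
  by rewrite -[RHS]uv0; apply: eq_bigr => k _; rewrite mxE.
rewrite psumr_eq0; last by move=> k _; rewrite mulr_ge0.
by move=> /allP/(_ i); rewrite mem_index_enum => /(_ isT)/eqP.
Qed.

(** Expanding the product leaves only the cross terms [- u v'] and [- u' v]. *)
Lemma complementary_antitone (R : realType) (n : nat) (u v u' v' : 'cV[R]_n) i :
  complementary u v -> complementary u' v' ->
  (u i 0 - u' i 0) * (v i 0 - v' i 0) <= 0.
Proof.
move=> uv uv'; have := complementary_entry i uv; have := complementary_entry i uv'.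
case: uv => /(_ i) u0 /(_ i) v0 _; case: uv' => /(_ i) u0' /(_ i) v0' _.
nra.
Qed.

(** Row [i] of [Pi y + lam - q], with the rank-one part of [Pi] written as a
    sum. *)
Definition residual_y (R : realType) (J : nat) (g : R)
    (q y lam : 'cV[R]_J) : 'cV[R]_J :=
  \col_i (g * (\sum_k y k 0 + y i 0) + lam i 0 - q i 0).

(** Complementarity of stacked vectors splits since each of the two inner
    products is nonnegative and their sum vanishes. *)
Lemma second_stage_blocks (R : realType) (J : nat) (eps g : R)
    (q x y lam : 'cV[R]_J) :
  second_stage eps g q x y lam ->
  complementary y (residual_y g q y lam) /\
  complementary lam (x - y + eps *: lam).
Proof.
rewrite /second_stage mul_block_col add_col_mx.
have -> : Pi_mx J g *m y + 1%:M *m lam + - q = residual_y g q y lam.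
  apply/colP => i; rewrite /Pi_mx mul1mx -scalemxAl mulmxDl mul1mx -mulmxA !mxE.
  congr (g * (_ + _) + _ - _); rewrite big_ord1 !mxE mul1r.
  by apply: eq_bigr => k _; rewrite !mxE mul1r.
have -> : - 1%:M *m y + eps%:M *m lam + x = x - y + eps *: lam.
  by rewrite mulNmx mul1mx mul_scalar_mx addrC addrA.
move=> [w0 r0]; rewrite tr_col_mx mul_row_col => wr.
have [y0 lam0] : (forall i, 0 <= y i 0) /\ (forall i, 0 <= lam i 0).
  by split=> i; [have := w0 (lshift _ i)|have := w0 (rshift _ i)];
    rewrite ?col_mxEu ?col_mxEd.
set r := residual_y _ _ _ _ in r0 wr *; set s := x - y + _ in r0 wr *.
have [ry0 s0] : (forall i, 0 <= r i 0) /\ (forall i, 0 <= s i 0).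
  by split=> i; [have := r0 (lshift _ i)|have := r0 (rshift _ i)];
    rewrite ?col_mxEu ?col_mxEd.
have dot0 (u v : 'cV[R]_J) : (forall i, 0 <= u i 0) -> (forall i, 0 <= v i 0) ->
    0 <= (u^T *m v) 0 0.
  by move=> u0 v0; rewrite mxE sumr_ge0// => i _; rewrite mxE mulr_ge0.
have e : (y^T *m r) 0 0 + (lam^T *m s) 0 0 = 0.
  by move/matrixP/(_ 0 0) : wr; rewrite !mxE.
have yr := dot0 _ _ y0 ry0; have ls := dot0 _ _ lam0 s0.
by split; split=> //; apply/matrixP => i j; rewrite !ord1 [RHS]mxE /=; lra.
Qed.

(** Adding the two blocks of [complementary_antitone] cancels the skew terms
    [(y - y') . (lam - lam')]; what remains is [(x - x') . (lam - lam')] plus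
    the quadratic forms of [Pi] and [eps I]. *)
Lemma second_stage_antitone (R : realType) (J : nat) (eps g : R)
    (q x y lam x' y' lam' : 'cV[R]_J) :
  0 <= g -> 0 <= eps ->
  second_stage eps g q x y lam -> second_stage eps g q x' y' lam' ->
  \sum_i (x i 0 - x' i 0) * (lam i 0 - lam' i 0) <= 0.
Proof.
move=> g0 eps0 /second_stage_blocks[cy cl] /second_stage_blocks[cy' cl'].
set dY := \sum_k y k 0 - \sum_k y' k 0.
have step i : (x i 0 - x' i 0) * (lam i 0 - lam' i 0)
    <= - (g * dY * (y i 0 - y' i 0)).
  have := complementary_antitone i cy cy'.
  have := complementary_antitone i cl cl'.
  rewrite !mxE; set Y := \sum_k _; set Y' := \sum_k _.
  move=> h1 h2.
  (* the diagonal parts of Pi and of eps I contribute these two squares *)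
  have h3 : 0 <= g * (y i 0 - y' i 0) ^+ 2 by rewrite mulr_ge0 ?sqr_ge0.
  have h4 : 0 <= eps * (lam i 0 - lam' i 0) ^+ 2 by rewrite mulr_ge0 ?sqr_ge0.
  rewrite /dY -/Y -/Y'; nra.
apply: le_trans (ler_sum _ (fun i _ => step i)) _.
rewrite sumrN -mulr_sumr sumrB -/dY oppr_le0 -mulrA mulr_ge0//.
by rewrite -expr2 sqr_ge0.
Qed.

(** If [lam i > 0], then [y i = x i + eps * lam i > 0], so row [i] of
    [Pi y + lam - q] vanishes; [Pi y >= 0] then gives [lam i <= q i]. *)
Lemma second_stage_multiplier_bounds (R : realType) (J : nat) (eps g p0 : R)
    (q x y lam : 'cV[R]_J) i :
  0 <= g -> 0 < eps -> 0 <= p0 -> 0 <= x i 0 -> q i 0 <= p0 ->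
  second_stage eps g q x y lam -> 0 <= lam i 0 <= p0.
Proof.
move=> g0 eps0 p00 x0 qp /second_stage_blocks[cy cl].
have := complementary_entry i cy; have := complementary_entry i cl.
case: cy cl => y0 _ _ [/(_ i) l0 _ _]; rewrite !mxE => els ely.
rewrite l0/=; have [l_le|l_gt] := lerP (lam i 0) 0; first exact: le_trans p00.
have el : 0 < eps * lam i 0 by rewrite mulr_gt0.
have {}els : x i 0 - y i 0 + eps * lam i 0 = 0.
  by move/eqP : els; rewrite mulf_eq0 gt_eqF//= => /eqP.
have yi : y i 0 != 0 by apply/eqP; lra.
move/eqP : ely; rewrite mulf_eq0 (negbTE yi)/= => /eqP e.
have : 0 <= g * (\sum_k y k 0 + y i 0) by rewrite mulr_ge0// addr_ge0 ?sumr_ge0.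
lra.
Qed.

(** * A strong law of large numbers for bounded variables *)

Lemma cvg_sqr0 (R : realType) (u : nat -> R) :
  u n ^+ 2 @[n --> \oo] --> (0 : R) -> u n @[n --> \oo] --> (0 : R).
Proof.
move=> u2; apply/norm_cvg0P.
have := cvg_comp _ _ u2 (@sqrt_continuous R 0).
rewrite sqrtr0; apply: cvg_trans; apply: near_eq_cvg; apply: nearW => k /=.
by rewrite sqrtr_sqr.
Qed.

Lemma sum_inv_sqr_le2 (R : realFieldType) (n : nat) :
  \sum_(k < n) (k.+1%:R ^+ 2)^-1 <= 2 :> R.
Proof.
suff : \sum_(k < n.+1) (k.+1%:R ^+ 2)^-1 <= 2 - n.+1%:R^-1 :> R.
  rewrite big_ord_recr/=; set r := (_ ^+ 2)^-1; set q := _^-1 => h.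
  have r0 : 0 <= r by rewrite invr_ge0 sqr_ge0.
  have q0 : 0 <= q by rewrite invr_ge0.
  lra.
(* 1/(t+1)^2 <= 1/t - 1/(t+1) makes the sum telescope *)
elim: n => [|n IH].
  by rewrite big_ord1 /= expr1n invr1 -(natrB _ (isT : (1 <= 2)%N)).
rewrite big_ord_recr/=.
have step (t : R) : 0 < t -> ((t + 1) ^+ 2)^-1 <= t^-1 - (t + 1)^-1.
  move=> t0; have -> : t^-1 - (t + 1)^-1 = (t * (t + 1))^-1.
    by field; rewrite !gt_eqF ?addr_gt0.
  by rewrite lef_pV2 ?posrE ?mulr_gt0 ?exprn_gt0 ?addr_gt0//; nra.
have := step n.+1%:R (ltr0Sn _ _); rewrite natr1 => h.
apply: le_trans (lerD IH h) _; rewrite addrA subrK.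
exact: lexx.
Qed.

Lemma between_squares (n : nat) : (0 < n)%N ->
  exists k, (k.+1 ^ 2 <= n < k.+2 ^ 2)%N.
Proof.
elim: n => // n IH _; have [->|n0] := posnP n; first by exists 0%N.
have [k /andP[kn nk]] := IH n0; have [h|h] := leqP (k.+2 ^ 2) n.+1.
  exists k.+1; rewrite h /=; apply: leq_ltn_trans nk _.
  by rewrite ltn_exp2r.
by exists k; rewrite h andbT ltnW.
Qed.

Lemma norm_increments_le (R : realFieldType) (s : nat -> R) (B : R) (m k : nat) :
  (forall n, `|s n.+1 - s n| <= B) -> `|s (m + k)%N - s m| <= B *+ k.
Proof.
move=> sB; elim: k => [|k IH]; first by rewrite addn0 subrr normr0.
rewrite addnS mulrS; apply: le_trans (lerD (sB (m + k)%N) IH).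
by apply: le_trans (ler_normD _ _); rewrite addrA subrK.
Qed.

(** For [k.+1 ^ 2 <= n < k.+2 ^ 2] fewer than [3 * k.+1] increments separate
    [s n] from [s (k.+1 ^ 2)], so the size of the mean at [n] exceeds that of
    the mean at [k.+1 ^ 2] by at most [3 * B / k.+1]. *)
Lemma cvg_mean_of_squares (R : realType) (s : nat -> R) (B : R) :
  (forall n, `|s n.+1 - s n| <= B) ->
  (k.+1%:R ^+ 2)^-1 * s (k.+1 ^ 2)%N @[k --> \oo] --> (0 : R) ->
  n%:R^-1 * s n @[n --> \oo] --> (0 : R).
Proof.
move=> sB sq; have B0 : 0 <= B := le_trans (normr_ge0 _) (sB 0%N).
have bnd : (`|(k.+1%:R ^+ 2)^-1 * s (k.+1 ^ 2)%N| + B * 3 * k.+1%:R^-1)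
    @[k --> \oo] --> (0 : R).
  rewrite -[X in _ --> X]addr0; apply: cvgD.
    by rewrite -(normr0 R); apply: cvg_norm.
  rewrite -[X in _ --> X](mulr0 (B * 3)); apply: cvgMl_tmp.
  exact: cvg_harmonic.
apply/cvgr0Pnorm_le => e e0.
move/cvgr0Pnorm_le/(_ e e0) : bnd => [K _ hK].
exists (K.+1 ^ 2)%N => // n /= Kn.
have n0 : (0 < n)%N by apply: leq_trans Kn; rewrite expn_gt0.
have [k /andP[kn nk]] := between_squares n0.
have Kk : (K <= k)%N.
  have : (K.+1 ^ 2 < k.+2 ^ 2)%N by apply: leq_ltn_trans Kn nk.
  by rewrite ltn_exp2r// ltnS.
have := hK k Kk; rewrite /= ger0_norm; last first.
  by rewrite addr_ge0// mulr_ge0 ?mulr_ge0// invr_ge0.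
apply: le_trans.
have t0 : 0 < k.+1%:R :> R by [].
have nR : k.+1%:R ^+ 2 <= n%:R :> R by rewrite -natrX ler_nat.
rewrite !normrM ![`|_^-1|]ger0_norm ?invr_ge0 ?sqr_ge0//.
have d1 := norm_increments_le (k.+1 ^ 2)%N (n - k.+1 ^ 2)%N sB.
rewrite subnKC// in d1.
have d2 : B *+ (n - k.+1 ^ 2) <= B * (3 * k.+1%:R).
  rewrite -[B *+ _]mulr_natr; apply: ler_wpM2l => //.
  by rewrite -(natrM _ 3) ler_nat; nia.
have d3 : `|s n| <= `|s (k.+1 ^ 2)%N| + B * (3 * k.+1%:R).
  rewrite -[s n](subrK (s (k.+1 ^ 2)%N)) addrC.
  by apply: le_trans (ler_normD _ _) _; rewrite lerD2l (le_trans d1).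
have sq0 : 0 < k.+1%:R ^+ 2 :> R by rewrite exprn_gt0.
apply: (@le_trans _ _ ((k.+1%:R ^+ 2)^-1 * `|s n|)).
  apply: ler_wpM2r; first exact: normr_ge0.
  by rewrite lef_pV2 ?posrE// (lt_le_trans sq0).
apply: (@le_trans _ _
  ((k.+1%:R ^+ 2)^-1 * (`|s (k.+1 ^ 2)%N| + B * (3 * k.+1%:R)))).
  by apply: ler_wpM2l => //; rewrite invr_ge0 ltW.
rewrite mulrDr lerD2l le_eqVlt; apply/orP; left; apply/eqP.
by field; rewrite gt_eqF.
Qed.

Section bounded_integrals.
Context d (T : measurableType d) (R : realType) (P : probability T R).

Lemma bounded_integrable (f : T -> R) (B : R) :
  measurable_fun setT f -> (forall t, `|f t| <= B) ->
  P.-integrable setT (fun t => (f t)%:E).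
Proof.
move=> mf fB; apply: measurable_bounded_integrable => //.
  by rewrite (le_lt_trans (probability_le1 _ _))// ltry.
exists B; split; first exact: num_real.
by move=> x Bx t _ /=; apply: le_trans (fB t) (ltW Bx).
Qed.

(** Orthogonality kills the off-diagonal terms of the expanded square. *)
Lemma orthogonal_square_integral (Z : nat -> T -> R) (B : R) (n : nat) :
  (forall l, measurable_fun setT (Z l)) -> (forall l t, `|Z l t| <= B) ->
  (forall i j, i != j -> (\int[P]_t (Z i t * Z j t)%:E = 0)%E) ->
  (\int[P]_t ((\sum_(l < n) Z l t) ^+ 2)%:E <= (n%:R * B ^+ 2)%:E)%E.
Proof.
move=> mZ ZB Zo.
have iZ i j : P.-integrable setT (fun t => (Z i t * Z j t)%:E).
  apply: (@bounded_integrable (fun t => Z i t * Z j t) (B * B)).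
    exact: measurable_funM.
  by move=> t; rewrite normrM ler_pM.
under eq_integral => t _ do
  rewrite expr2 big_distrlr/= pair_big/= -sumEFin.
rewrite integral_sum//.
rewrite -(pair_bigA _ (fun i j : 'I_n => (\int[P]_t (Z i t * Z j t)%:E)%E))/=.
apply: (@le_trans _ _ (\sum_(i < n) (B ^+ 2)%:E)%E); last first.
  by rewrite sumEFin lee_fin sumr_const card_ord mulr_natl.
apply: lee_sum => i _; rewrite (bigD1 i)//= big1 ?adde0; last first.
  by move=> j ji; rewrite Zo// eq_sym.
apply: (@le_trans _ _ (\int[P]_t (cst (B ^+ 2)%:E t))%E); last first.
  by rewrite integral_cst// [X in (_ * X)%E](@probability_setT _ _ _ P) mule1.
apply: le_integral => //.
  exact: (@bounded_integrable (cst (B ^+ 2)) `|B ^+ 2|).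
move=> t _; rewrite lee_fin -expr2 -real_normK ?num_real//.
by rewrite lerXn2r// nnegrE (le_trans _ (ZB i t)).
Qed.

(** The expectation of the squared mean of the first [k.+1 ^ 2] variables is at
    most [B ^ 2 / k.+1 ^ 2].  By monotone convergence the sum of these squared
    means has a finite expectation, so it is finite almost surely and its terms
    tend to [0]. *)
Lemma orthogonal_strong_law (Z : nat -> T -> R) (B : R) :
  (forall l, measurable_fun setT (Z l)) -> (forall l t, `|Z l t| <= B) ->
  (forall i j, i != j -> (\int[P]_t (Z i t * Z j t)%:E = 0)%E) ->
  {ae P, forall t, n%:R^-1 * \sum_(l < n) Z l t @[n --> \oo] --> (0 : R)}.
Proof.
move=> mZ ZB Zo.
pose A k t : R := ((k.+1%:R ^+ 2)^-1 * \sum_(l < k.+1 ^ 2) Z l t) ^+ 2.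
have A0 k t : 0 <= A k t by exact: sqr_ge0.
have mA k : measurable_fun setT (A k).
  apply: measurable_funX; apply: measurable_funM => //.
  exact: measurable_sum.
have iA k : (\int[P]_t (A k t)%:E <= (B ^+ 2 * (k.+1%:R ^+ 2)^-1)%:E)%E.
  rewrite /A; under eq_integral => t _ do rewrite exprMn EFinM.
  rewrite ge0_integralZl_EFin; last 4 first.
  - exact: measurableT.
  - by move=> t _; rewrite lee_fin sqr_ge0.
  - by apply/measurable_EFinP; apply: measurable_funX; apply: measurable_sum.
  - exact: sqr_ge0.
  apply: le_trans (lee_wpmul2l _ (orthogonal_square_integral _ mZ ZB Zo)) _.
    by rewrite lee_fin sqr_ge0.
  rewrite -EFinM lee_fin natrX le_eqVlt; apply/orP; left; apply/eqP.
  by rewrite expr2 -mulrA mulKf ?expf_neq0 ?pnatr_eq0// mulrC.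
have mEA k : measurable_fun setT (fun t => (A k t)%:E) by exact/measurable_EFinP.
have sA : (\int[P]_t (\sum_(k <oo) (A k t)%:E) < +oo)%E.
  rewrite integral_nneseries//; last by move=> k t _; rewrite lee_fin.
  apply: (@le_lt_trans _ _ (B ^+ 2 * 2)%:E%E); last exact: ltry.
  apply: lime_le.
    apply: is_cvg_nneseries => k _ _; apply: integral_ge0 => t _.
    by rewrite lee_fin.
  apply: nearW => n; rewrite big_mkord.
  apply: (@le_trans _ _ (\sum_(k < n) (B ^+ 2 * (k.+1%:R ^+ 2)^-1)%:E)%E).
    by apply: lee_sum => k _; exact: iA.
  by rewrite sumEFin lee_fin -mulr_sumr ler_wpM2l ?sqr_ge0// sum_inv_sqr_le2.
have intA : P.-integrable setT (fun t => \sum_(k <oo) (A k t)%:E)%E.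
  apply/integrableP; split.
    by apply: ge0_emeasurable_sum => // k t _ _; rewrite lee_fin.
  rewrite (eq_integral (fun t => \sum_(k <oo) (A k t)%:E)%E)// => t _.
  by rewrite gee0_abs// nneseries_ge0// => k _ _; rewrite lee_fin.
move: (integrable_ae measurableT intA); apply: filterS => t /(_ I) fA.
have cA : A k t @[k --> \oo] --> (0 : R).
  apply: cvg_series_cvg_0; apply: nnseries_is_cvg => //.
  by rewrite ltey_eq fA.
apply: (@cvg_mean_of_squares _ (fun n => \sum_(l < n) Z l t) B).
  by move=> n; rewrite big_ord_recr/= addrAC subrr add0r.
exact: cvg_sqr0 cA.
Qed.

End bounded_integrals.

Section independence.
Context d (Omega : measurableType d) (R : realType) (P : probability Omega R).

(** The product rule on rectangles identifies the joint law with the product of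
    the two laws, where Fubini's theorem applies. *)
Lemma independent_expectationM d1 d2 (T1 : measurableType d1)
    (T2 : measurableType d2) (X : {RV P >-> T1}) (Y : {RV P >-> T2})
    (f : T1 -> R) (g : T2 -> R) (B : R) :
  (forall A C, measurable A -> measurable C ->
     P (X @^-1` A `&` Y @^-1` C) = (P (X @^-1` A) * P (Y @^-1` C))%E) ->
  measurable_fun setT f -> measurable_fun setT g ->
  (forall x, `|f x| <= B) -> (forall y, `|g y| <= B) ->
  (\int[P]_w (f (X w) * g (Y w))%:E =
   \int[P]_w (f (X w))%:E * \int[P]_w (g (Y w))%:E)%E.
Proof.
move=> XY mf mg fB gB.
have mX : measurable_fun setT X := measurable_funPT X.
have mY : measurable_fun setT Y := measurable_funPT Y.
have mfX : measurable_fun setT (f \o X) by exact: measurableT_comp.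
have mgY : measurable_fun setT (g \o Y) by exact: measurableT_comp.
pose h w := (X w, Y w).
have mh : measurable_fun setT h by exact: measurable_fun_pair.
pose hM := isMeasurableFun.Build _ _ _ _ h mh.
pose hR : {RV P >-> (T1 * T2)%type} := HB.pack h hM.
pose F (z : T1 * T2) : R := f z.1 * g z.2.
have mF : measurable_fun setT F.
  by apply: measurable_funM; apply: measurableT_comp.
have FB z : `|F z| <= B * B by rewrite normrM ler_pM.
have dXY A : measurable A ->
    (distribution P X \x distribution P Y)%E A = distribution P hR A.
  by apply: product_measure_unique => C D mC mD; rewrite -XY.
transitivity (\int[distribution P hR]_z (F z)%:E)%E.
  rewrite integral_distribution//; first exact/measurable_EFinP.
  exact: (bounded_integrable _ (f := F \o h) (B := B * B)
            (measurableT_comp mF mh) (fun w => FB (h w))).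
transitivity (\int[(distribution P X \x distribution P Y)]_z (F z)%:E)%E.
  by apply: eq_measure_integral => A mA _; exact/esym/dXY.
rewrite -integral12_prod_meas1; last first.
  apply: measurable_bounded_integrable => //.
    rewrite [ltLHS](dXY _ measurableT).
    by apply: le_lt_trans (probability_le1 _ _) _ => //; exact: ltry.
  exists (B * B); split; first exact: num_real.
  by move=> x Bx t _ /=; apply: le_trans (FB t) (ltW Bx).
rewrite /fubini_F.
have ig : (distribution P Y).-integrable setT (EFin \o g).
  exact: bounded_integrable _ mg gB.
have if_ : (distribution P X).-integrable setT (EFin \o f).
  exact: bounded_integrable _ mf fB.
have Eg : (\int[distribution P Y]_y (g y)%:E = (\int[distribution P Y]_y g y)%:E)%E.
  by rewrite fineK// integrable_fin_num.
under eq_integral => x _.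
  under eq_integral => y _ do rewrite /F/= EFinM.
  rewrite integralZl// Eg.
  over.
rewrite /= integralZr// -Eg.
congr (_ * _)%E.
  by rewrite integral_distribution//; [exact/measurable_EFinP|
    exact: (bounded_integrable _ (f := f \o X) mfX (fun w => fB (X w)))].
by rewrite integral_distribution//; [exact/measurable_EFinP|
    exact: (bounded_integrable _ (f := g \o Y) mgY (fun w => gB (Y w)))].
Qed.
End independence.

(** Centring by the common mean turns pairwise independence into
    orthogonality. *)
Lemma bounded_iid_strong_law (R : realType) (d0 dO dT : measure_display)
    (Omega0 : measurableType d0) (Omega : measurableType dO)
    (T : measurableType dT) (P0 : probability Omega0 R)
    (xi : {RV P0 >-> T}) (Pr : probability Omega R)
    (X : nat -> {RV Pr >-> T}) (f : T -> R) (B : R) :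
  iid_samples xi X -> measurable_fun setT f -> (forall z, `|f z| <= B) ->
  {ae Pr, forall w, n%:R^-1 * \sum_(l < n) f (X l w) @[n --> \oo] -->
     (\int[distribution P0 xi]_z f z : R)}.
Proof.
move=> [indep same] mf fB.
have fi : (distribution P0 xi).-integrable setT (EFin \o f).
  exact: bounded_integrable _ mf fB.
set m : R := \int[distribution P0 xi]_z f z.
have mX l : measurable_fun setT (X l) := measurable_funPT (X l).
have gB z : `|f z - m| <= B + `|m|.
  by apply: le_trans (ler_normB _ _) _; rewrite lerD2r.
have mg : measurable_fun setT (fun z => f z - m) by exact: measurable_funB.
have mean0 l : (\int[Pr]_w (f (X l w) - m)%:E = 0)%E.
  transitivity (\int[distribution Pr (X l)]_z (f z - m)%:E)%E.
    rewrite integral_distribution//; first exact/measurable_EFinP.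
    exact: (bounded_integrable _ (f := (fun z => f z - m) \o X l)
              (measurableT_comp mg (mX l)) (fun w => gB _)).
  transitivity (\int[distribution P0 xi]_z (f z - m)%:E)%E.
    by apply: eq_measure_integral => A mA _; exact: same.
  under eq_integral do rewrite EFinB.
  rewrite integralB//; last first.
    exact: (bounded_integrable _ (f := cst m) (B := `|m|)).
  rewrite integral_cst//.
  rewrite [X in (_ - _ * X)%E](@probability_setT _ _ _ (distribution P0 xi)).
  rewrite mule1.
  rewrite -[X in (X - _)%E]fineK ?integrable_fin_num//.
  by rewrite -EFinB subrr.
have := @orthogonal_strong_law _ _ _ Pr (fun l w => f (X l w) - m) (B + `|m|).
move=> /(_ (fun l => measurableT_comp mg (mX l)) (fun l w => gB _)) H.
have {}H := H _; move: H => /(_ _)/wrap[].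
  move=> i j ij.
  rewrite (independent_expectationM (f := fun z => f z - m)
    (g := fun z => f z - m) (B := B + `|m|))// ?mean0 ?mul0e// => A C mA mC.
  have := indep [:: i; j] (fun k => if k == i then A else C).
  rewrite /= inE ij/= => /(_ isT) /(_ _)/wrap[]; first by move=> k; case: ifP.
  rewrite !big_cons big_nil mule1 eqxx eq_sym (negbTE ij) => <-.
  congr (Pr _); apply/seteqP; split => w /=.
    move=> [iA jC] k /=; rewrite !inE => /orP[/eqP->|/eqP->].
      by rewrite eqxx.
    by rewrite eq_sym (negbTE ij).
  move=> H; split.
    by have := H i; rewrite /= !inE eqxx/=; apply.
  by have := H j; rewrite /= !inE eqxx orbT eq_sym (negbTE ij)/=; apply.
apply: filterS => w H.
have : n%:R^-1 * (\sum_(l < n) (f (X l w) - m)) + m @[n --> \oo] --> 0 + m.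
  by apply: cvgD; [exact: H|exact: cvg_cst].
rewrite add0r; apply: cvg_trans.
apply: near_eq_cvg; exists 1%N => // n /= n0.
rewrite sumrB sumr_const card_ord -[m *+ n]mulr_natl mulrBr.
rewrite mulKf ?pnatr_eq0 -?lt0n//.
by rewrite subrK.
Qed.

(** * From Monte Carlo means to the sample average solutions *)

Lemma cvg_cV (R : realType) (J : nat) (u : nat -> 'cV[R]_J) (x : 'cV[R]_J) :
  (forall j, u n j 0 - x j 0 @[n --> \oo] --> (0 : R)) ->
  u n @[n --> \oo] --> x.
Proof.
move=> ux; apply/cvg_ballP => e e0.
have : \forall n \near \oo, forall j, `|u n j 0 - x j 0| < e.
  apply: filter_forall => j; have /cvgr0Pnorm_lt := ux j; exact.
apply: filterS => n h; split=> // i j; rewrite ord1.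
by rewrite /ball/= distrC; exact: h.
Qed.

(** The right-hand side only involves the Monte Carlo error of [lame], whose
    expectation will be [m].  The replacement of [lam] by [lame] is free by
    [second_stage_antitone], and Young's inequality
    [2 D E <= c D ^ 2 + E ^ 2 / c] absorbs the factor [x - xe] on the right. *)
Lemma saa_solution_error (R : realType) (d J : nat)
    (c : 'rV[R]_J) (a : 'cV[R]_J) (gamma : 'rV[R]_d -> R)
    (p : 'rV[R]_d -> 'cV[R]_J) (eps : R) (nu : nat) (z : 'I_nu -> 'rV[R]_d)
    (x xe m : 'cV[R]_J) (y lam ye lame : 'I_nu -> 'cV[R]_J) (j : 'I_J) :
  (forall k, 0 < c 0 k) -> 0 <= eps ->
  (forall l, 0 <= gamma (z l)) ->
  saa_solution c a gamma p eps z x y lam ->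
  complementary xe (diag_mx c *m xe - m + a) ->
  (forall l, second_stage eps (gamma (z l)) (p (z l)) xe (ye l) (lame l)) ->
  c 0 j * (x j 0 - xe j 0) ^+ 2 <=
  \sum_k (c 0 k)^-1 * (nu%:R^-1 * \sum_(l < nu) lame l k 0 - m k 0) ^+ 2.
Proof.
move=> c0 eps0 g0 [cx ss] cxe sse.
pose D k := x k 0 - xe k 0.
pose E k := nu%:R^-1 * \sum_(l < nu) lame l k 0 - m k 0.
have step k : c 0 k * D k ^+ 2 <=
    (c 0 k)^-1 * E k ^+ 2
    + 2 * (nu%:R^-1 * \sum_(l < nu) D k * (lam l k 0 - lame l k 0)).
  set A := \sum_(l < nu) lam l k 0.
  have -> : \sum_(l < nu) D k * (lam l k 0 - lame l k 0) =
      D k * (A - \sum_(l < nu) lame l k 0) by rewrite -mulr_sumr sumrB.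
  have := complementary_antitone k cx cxe.
  rewrite !mul_diag_mx !mxE summxE -/A -/(D k) /E.
  set L := \sum_(l < nu) lame l k 0; set t := nu%:R^-1.
  have young : 0 <= c 0 k * D k ^+ 2 - 2 * D k * (t * L - m k 0)
                 + (c 0 k)^-1 * (t * L - m k 0) ^+ 2.
    have -> : c 0 k * D k ^+ 2 - 2 * D k * (t * L - m k 0)
        + (c 0 k)^-1 * (t * L - m k 0) ^+ 2
        = c 0 k * (D k - (c 0 k)^-1 * (t * L - m k 0)) ^+ 2.
      by field; rewrite gt_eqF.
    by rewrite mulr_ge0 ?sqr_ge0// ltW.
  have -> : x k 0 = D k + xe k 0 by rewrite subrK.
  move: young; set q := (c 0 k)^-1; move: (c 0 k) (D k) q => ck Dk q; nra.
have ck0 k : 0 <= c 0 k * D k ^+ 2 by rewrite mulr_ge0 ?sqr_ge0// ltW.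
apply: (@le_trans _ _ (\sum_k c 0 k * D k ^+ 2)).
  by rewrite (bigD1 j)//= lerDl sumr_ge0.
apply: le_trans (ler_sum _ (fun k _ => step k)) _.
rewrite big_split/= gerDl -mulr_sumr pmulr_rle0// -mulr_sumr exchange_big/=.
rewrite mulr_ge0_le0 ?invr_ge0// sumr_le0// => l _.
exact: second_stage_antitone (g0 l) eps0 (ss l) (sse l).
Qed.

(** The samples have the law of [xi], so each of them avoids a given null set
    almost surely, and there are countably many of them. *)
Lemma ae_sample (R : realType) (d0 dO dT : measure_display)
    (Omega0 : measurableType d0) (Omega : measurableType dO)
    (T : measurableType dT) (P0 : probability Omega0 R)
    (xi : {RV P0 >-> T}) (Pr : probability Omega R)
    (X : nat -> {RV Pr >-> T}) (Q : T -> Prop) :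
  iid_samples xi X -> {ae distribution P0 xi, forall z, Q z} ->
  {ae Pr, forall w, forall l, Q (X l w)}.
Proof.
move=> [_ same] [N [mN N0 QN]]; apply: ae_foralln => l.
exists (X l @^-1` N); split.
- by rewrite -[X in measurable X]setTI; exact: measurable_funPT.
- by rewrite -[RHS]N0; exact: same.
- by move=> w /= nQ; apply: QN.
Qed.

Theorem theorem4p2 (R : realType) (d J : nat) (hJ : (0 < J)%N)
    (* the random vector xi, its law and its support *)
    (d0 : measure_display) (Omega0 : measurableType d0)
    (P0 : probability Omega0 R) (xi : {RV P0 >-> borel_rV R d})
    (Xi : set 'rV[R]_d) (hXi : is_support (distribution P0 xi) Xi)
    (* the data *)
    (c : 'rV[R]_J) (hc : forall j, 0 < c 0 j)
    (a : 'cV[R]_J) (ha : forall j, 0 < a j 0)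
    (p : 'rV[R]_d -> 'cV[R]_J)
    (hp : forall j,
       measurable_fun (Xi : set (borel_rV R d)) (fun z => p z j 0))
    (gamma : 'rV[R]_d -> R)
    (hgamma : measurable_fun (Xi : set (borel_rV R d)) gamma)
    (hgamma_ge0 : forall z, Xi z -> 0 <= gamma z)
    (gamma0 : R) (hgamma0 : 0 < gamma0)
    (hgamma_ge : {ae distribution P0 xi, forall z, Xi z -> gamma0 <= gamma z})
    (p0 : R) (hp0 : 0 < p0)
    (hp_le : forall j,
       {ae distribution P0 xi, forall z, Xi z -> p z j 0 <= p0})
    (eps : R) (heps : 0 < eps)
    (* the x-component of the solution of the regularized problem *)
    (xe : 'cV[R]_J)
    (hxe : exists y lam : 'rV[R]_d -> 'cV[R]_J,
       regularized_solution (distribution P0 xi) Xi c a gamma p eps xe y lam)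
    (* X 0, X 1, ... are the samples xi_1, xi_2, ... *)
    (dO : measure_display) (Omega : measurableType dO)
    (Pr : probability Omega R) (X : nat -> {RV Pr >-> borel_rV R d})
    (hX : iid_samples xi X)
    (* the x-components of the solutions of the sample average problems *)
    (xnu : nat -> Omega -> 'cV[R]_J)
    (hxnu : forall nu, (0 < nu)%N ->
       {ae Pr, forall w, exists y lam : 'I_nu -> 'cV[R]_J,
         saa_solution c a gamma p eps (fun l : 'I_nu => X l w)
           (xnu nu w) y lam}) :
  {ae Pr, forall w, xnu nu w @[nu --> \oo] --> xe}.
Proof.
case: hxe => ye [lame [_ ilame cxe sse]].
have mXi : measurable (Xi : set (borel_rV R d)).
  case: hXi => cXi _ _; rewrite -[Xi]setCK; apply: measurableC.
  by apply: sub_sigma_algebra; exact: closed_openC.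
have aeF : Filter (almost_everywhere (distribution P0 xi)).
  exact: ae_filter_ringOfSetsType.
have aeXi : {ae distribution P0 xi, forall z, Xi z}.
  case: hXi => _ muXi _; exists (~` Xi); split=> //; first exact: measurableC.
  by rewrite [LHS](probability_setC _ mXi) [X in (_ - X)%E]muXi subee.
have xe0 j : 0 <= xe j 0 by case: cxe.
have bnd : {ae distribution P0 xi, forall z, [/\ Xi z,
    second_stage eps (gamma z) (p z) xe (ye z) (lame z) &
    forall j, 0 <= lame z j 0 <= p0]}.
  have aep : {ae distribution P0 xi, forall z j, Xi z -> p z j 0 <= p0}.
    exact: filter_forall.
  move: aeXi sse aep; apply: filterS3 => z Xz /(_ Xz) ssz pz; split=> // j.
  apply: second_stage_multiplier_bounds ssz => //; last exact: pz.
    exact: hgamma_ge0.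
  exact: ltW.
(* lame is measurable on Xi only and bounded almost everywhere only; clipping
   it to [0, p0] and extending it by 0 gives a bounded measurable function of
   all of R^d that agrees with it at almost every scenario *)
pose f j : borel_rV R d -> R :=
  (fun z => Num.min (Num.max (lame z j 0) 0) p0) \_ Xi.
have mf j : measurable_fun setT (f j).
  rewrite /f -(measurable_restrictT _ mXi).
  apply: (measurable_minr (f := fun z : borel_rV R d => Num.max (lame z j 0) 0)
    (g := cst p0)) => //.
  apply: (measurable_maxr (f := fun z : borel_rV R d => lame z j 0)
    (g := cst 0)) => //.
  apply/measurable_EFinP.
  exact: measurable_int (ilame j).
have fB j z : `|f j z| <= p0.
  rewrite /f patchE; case: ifP => _; last by rewrite normr0 ltW.
  rewrite ger0_norm; first by rewrite ge_min lexx orbT.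
  by rewrite le_min le_max lexx orbT ltW.
have fE z j : Xi z -> 0 <= lame z j 0 <= p0 -> f j z = lame z j 0.
  move=> Xz /andP[l0 lp]; rewrite /f patchE mem_set//.
  by rewrite (max_idPl l0) (min_idPl lp).
have intf j : \int[distribution P0 xi]_z f j z =
    \int[distribution P0 xi]_(z in Xi) lame z j 0.
  rewrite [RHS]Rintegral_mkcond /Rintegral; congr fine.
  apply: ae_eq_integral => //.
  - exact/measurable_EFinP.
  - apply/measurable_EFinP; rewrite -(measurable_restrictT _ mXi).
    apply/measurable_EFinP.
    exact: measurable_int (ilame j).
  - move: bnd; apply: filterS => z [Xz _ lz] _.
    by rewrite fE// patchE mem_set.
have law : {ae Pr, forall w, forall j,
    n%:R^-1 * \sum_(l < n) f j (X l w) @[n --> \oo] -->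
      (\int[distribution P0 xi]_z f j z : R)}.
  by apply: filter_forall => j; exact: bounded_iid_strong_law (mf j) (fB j).
have sol : {ae Pr, forall w, forall n, (0 < n)%N ->
    exists y lam : 'I_n -> 'cV[R]_J,
      saa_solution c a gamma p eps (fun l : 'I_n => X l w) (xnu n w) y lam}.
  apply: ae_foralln => n; have [->|n0] := posnP n; first exact: aeW.
  by move: (hxnu n n0); apply: filterS.
move: law sol (ae_sample hX bnd); apply: filterS3 => w lw sw bw.
apply: cvg_cV => j; apply: cvg_sqr0.
pose E n k :=
  n%:R^-1 * \sum_(l < n) f k (X l w) - \int[distribution P0 xi]_z f k z.
apply: (@squeeze_cvgr _ _ _ _ (fun=> 0)
  (fun n => (c 0 j)^-1 * \sum_k (c 0 k)^-1 * E n k ^+ 2)); last 2 first.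
- exact: cvg_cst.
- have E0 k : E n k ^+ 2 @[n --> \oo] --> (0 : R).
    rewrite -[X in _ --> X](mulr0 0).
    have Ek : E n k @[n --> \oo] --> (0 : R).
      rewrite -(subrr (\int[distribution P0 xi]_z f k z)).
      by apply: cvgB; [exact: lw|exact: cvg_cst].
    exact: (cvgM Ek Ek).
  have S0 : (\sum_(k < J) (c 0 k)^-1 * E n k ^+ 2) @[n --> \oo] -->
      \sum_(k < J) (c 0 k)^-1 * (0 : R).
    by apply: (cvg_big (op := +%R)); [exact: add_continuous|
      move=> k _; exact: cvgMl_tmp].
  rewrite [X in _ --> X](_ : 0 =
    (c 0 j)^-1 * \sum_(k < J) (c 0 k)^-1 * (0 : R)); last first.
    by rewrite big1 ?mulr0// => k _; rewrite mulr0.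
  exact: cvgMl_tmp.
exists 1%N => // n /= n0; rewrite sqr_ge0/=.
have [y [lam saa]] := sw n n0.
rewrite -ler_pdivrMl ?invr_gt0// invrK.
have fl (l : 'I_n) k : f k (X l w) = lame (X l w) k 0.
  by have [Xz _ /(_ k)] := bw l; exact: fE.
have := @saa_solution_error _ _ _ c a gamma p eps n (fun l => X l w) (xnu n w) xe
  (\col_k \int[distribution P0 xi]_(z in Xi) lame z k 0) y lam
  (fun l => ye (X l w)) (fun l => lame (X l w)) j hc (ltW heps) _ saa cxe.
move=> /(_ _ _)/wrap[].
- by move=> l; apply: hgamma_ge0; have [] := bw l.
- by move=> l; have [] := bw l.
move=> /le_trans; apply; rewrite le_eqVlt; apply/orP; left; apply/eqP.
apply: eq_bigr => k _; rewrite mxE -intf; congr (_ * (_ * _ - _) ^+ 2).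
by apply: eq_bigr => l _; rewrite fl.
Qed.
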